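(* Let $T$ be a triangle in the plane and let $k$ be a positive integer. Any finite set of points in the plane can be colored with $k$ colors so that any homothet of $T$ containing at least $m_k=12\cdot 23^{\lceil \log_2 k\rceil-1}$ of the points contains points of all $k$ colors. Moreover $m_k\le 12\cdot k^{\log_2 23}=O(k^{4.53})$.
   Context: A homothet of a planar set $T$ is a set of the form $\lambda T+v$ with $\lambda>0$ and $v\in\mathbb R^2$. Triangles are closed, non-degenerate regions. *)

(* Defs.v *)
From HB Require Import structures.
From mathcomp Require Import all_boot all_order all_algebra finmap.
From mathcomp Require Import all_classical all_reals all_analysis.

Set Implicit Arguments.
Unset Strict Implicit.
Unset Printing Implicit Defensive.

Import Order.TTheory GRing.Theory Num.Theory numFieldNormedType.Exports.

Local Open Scope classical_set_scope.
Local Open Scope ring_scope.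

Definition convex_hull (R : realType) (A : set 'rV[R]_2) : set 'rV[R]_2 :=
  smallest (@convex_set R 'rV[R]_2) A.

Definition is_triangle (R : realType) (T : set 'rV[R]_2) : Prop :=
  exists a b c : 'rV[R]_2,
    free [:: b - a; c - a] /\ T = convex_hull [set a; b; c].

Definition homothet (R : realType) (T H : set 'rV[R]_2) : Prop :=
  exists (l : R) (v : 'rV[R]_2), 0 < l /\ H = [set l *: x + v | x in T].

Definition log2 (R : realType) (x : R) : R := ln x / ln 2.

(* The exponent is an integer, equal to -1 when k = 1, so the value is real
   rather than natural: [threshold R 1 = 12 / 23]. *)
Definition threshold (R : realType) (k : nat) : R :=
  12 * (23 : R) ^ (Num.ceil (log2 (k%:R : R)) - 1).

(* Main.v *)
(* In barycentric coordinates a homothet of T becomes an octant {x <= X, y <= Y,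
   z <= Z}, and the plane x + y + z = 0 is an antichain.

   Two colours, 12 points.  Let the points arrive by increasing x; an octant is
   then a wedge {y <= Y, z <= Z} at some time.  Colour points lazily.  An
   arriving point stays uncoloured, and the uncoloured points it lies below are
   promised the opposite of its colour; hence a wedge can only become
   monochromatic if its uncoloured points are minimal, which makes them an
   antichain f1, f2, ... ordered by y, and if its coloured points share a
   colour.  Whenever such a wedge contains five uncoloured points, the third of
   them is coloured against that wedge.  If this gives another wedge W a further
   point of its own colour, then W extends beyond f1 or beyond f5, say f1, and
   all coloured points of W have a larger z than f1: from then on W has a
   coloured point with smaller z than f1 and f2, and neither of these can again
   serve in this way on that side.  With at most five uncoloured points at a
   time this happens a bounded number of times, leaving at most 7 coloured and
   4 uncoloured points in W.

   2k colours.  Two-colour, then colour each class with k colours.  If an octant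
   has j < m points of one class, its other points are covered by 2j + 1 octants
   avoiding those j points, each with at most 11 points, so it has at most
   j + 11 (2j + 1) < 23 m points. *)

From mathcomp Require Import all_boot zify boolp.

Set Implicit Arguments.
Unset Strict Implicit.
Unset Printing Implicit Defensive.

(** * Wedges with few coloured points *)

Section DeadFrees.
Variable T : finType.
Implicit Types (u y z : T -> nat) (F C : {set T}).

(* In a wedge with uncoloured points F and coloured points C, an uncoloured
   point that is dead for both coordinates can no longer receive the colour of
   C: see [sparse_colour_middle]. *)
Definition dead u F C := [set f in F | [exists v in C, u v < u f]].

(** Here [d] counts the uncoloured points dead for both coordinates, [s] those dead for at least
    one. While [d] stays 0, every coloured point after the first raises [s]; since [s <= 5], at most
    6 points are coloured when [d] becomes positive. One further point lifts [d] to at least 3, and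
    then none can follow. *)
Definition coloured_bound (d s : nat) : nat :=
  if d == 0 then maxn 1 s else if d <= 2 then 6 else 7.

Definition few_coloured y z F C :=
  #|C| <= coloured_bound #|dead y F C :&: dead z F C|
                         #|dead y F C :|: dead z F C|.

Lemma deadP u F C f :
  reflect (f \in F /\ exists2 v, v \in C & u v < u f) (f \in dead u F C).
Proof.
rewrite inE; apply: (iffP andP) => -[fF]; first by case/exists_inP=> v vC lt; split=> //; exists v.
by case=> v vC lt; split=> //; apply/exists_inP; exists v.
Qed.

Lemma dead_sub u F C : dead u F C \subset F.
Proof. by apply/subsetP=> f /deadP[]. Qed.

Lemma dead_mono u F F' C C' :
  F \subset F' -> C \subset C' -> dead u F C \subset dead u F' C'.
Proof.
move=> sF sC; apply/subsetP=> f /deadP[fF [v vC lt]]; apply/deadP; split.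
  exact: (subsetP sF).
by exists v => //; apply: (subsetP sC).
Qed.

Lemma few_colouredC y z F C : few_coloured y z F C = few_coloured z y F C.
Proof. by rewrite /few_coloured setIC setUC. Qed.

Lemma few_coloured_le7 y z F C :
  #|F| <= 7 -> few_coloured y z F C -> #|C| <= 7.
Proof.
move=> F7; rewrite /few_coloured /coloured_bound.
have := subset_leq_card (_ : dead y F C :|: dead z F C \subset F).
by rewrite subUset !dead_sub => /(_ isT); case: ifP => _; last case: ifP => _; lia.
Qed.

Lemma coloured_bound_ge6 d s : 0 < d -> 6 <= coloured_bound d s.
Proof. by case: d => // d _; rewrite /coloured_bound /=; case: ifP. Qed.

(** The bound [s <= 6] serves the passage from [d = 0] to [d' > 0], where [maxn 1 s] must not exceed
    6. *)
Lemma coloured_bound_mono d d' s s' :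
  d <= d' -> s <= s' -> s <= 6 -> coloured_bound d s <= coloured_bound d' s'.
Proof.
by rewrite /coloured_bound; case: (d =P 0); case: (d' =P 0) => *; do ?case: ifP => *; lia.
Qed.

Lemma few_coloured_more_free y z F F' C :
  F \subset F' -> #|F| <= 6 -> few_coloured y z F C -> few_coloured y z F' C.
Proof.
move=> sF F6 /leq_trans; apply; apply: coloured_bound_mono.
- by apply/subset_leq_card/setISS; apply: dead_mono.
- by apply/subset_leq_card/setUSS; apply: dead_mono.
by apply: leq_trans F6; rewrite subset_leq_card // subUset !dead_sub.
Qed.

(** No coloured point has smaller [z] than [f1] or [f2], so neither was dead for [z]; colouring [f3]
    makes both dead, which pays for the additional coloured point. *)
Lemma few_coloured_step y z F C f1 f2 f3 :
  {in F &, forall f g, y f <= y g -> z f <= z g -> f = g} ->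
  f1 \in F -> f2 \in F -> f3 \in F -> y f1 < y f2 < y f3 -> z f3 < z f2 < z f1 ->
  {in C, forall v, z f1 < z v} -> #|F| <= 5 ->
  few_coloured y z F C -> few_coloured y z (F :\ f3) (f3 |: C).
Proof.
move=> anti F1 F2 F3 /andP[y12 y23] /andP[z32 z21] Cz F5.
have ne (a b : T) : y a < y b -> a != b by move=> lt; apply: contraTneq lt => ->; rewrite ltnn.
have z31 := ltn_trans z32 z21.
have n12 := ne _ _ y12; have n23 := ne _ _ y23; have n13 := ne _ _ (ltn_trans y12 y23).
rewrite /few_coloured; set D := dead z F C; set L := dead y F C.
set F' := F :\ f3; set C' := f3 |: C; set D' := dead z F' C'; set L' := dead y F' C'.
have notD f : z f <= z f1 -> f \notin D.
  by move=> le; apply/deadP=> -[_ [v /Cz lt]]; rewrite ltnNge ltnW // (leq_ltn_trans le lt).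
have F1' : f1 \in F' by rewrite !inE n13.
have F2' : f2 \in F' by rewrite !inE n23.
have C3 : f3 \in C' by rewrite !inE eqxx.
have sC : C \subset C' by apply: subsetUr.
have sD : D \subset D'.
  apply/subsetP=> f fD; have /deadP[fF [v vC lt]] := fD; apply/deadP; split.
    by apply/setD1P; split=> //; apply: contraTneq fD => ->; apply: notD; apply: ltnW.
  by exists v => //; apply: (subsetP sC).
have sL : L :\ f3 \subset L'.
  apply/subsetP=> f /setD1P[nf /deadP[fF [v vC lt]]]; apply/deadP; split.
    by apply/setD1P.
  by exists v => //; apply: (subsetP sC).
have D1 : f1 \in D' by apply/deadP; split=> //; exists f3.
have D2 : f2 \in D' by apply/deadP; split=> //; exists f3.
have ND1 : f1 \notin D by apply: notD.
have ND2 : f2 \notin D by apply: notD; apply: ltnW.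
have ND3 : f3 \notin D by apply: notD; apply: ltnW.
have cardC : #|C'| <= #|C|.+1 by rewrite /C' cardsU1 -addn1 addnC leq_add2l leq_b1.
have sF : D :|: L \subset F by rewrite subUset !dead_sub.
have sle'' : #|L :|: D| <= 5 by rewrite setUC (leq_trans (subset_leq_card sF)).
have [DL0|[o]] := set_0Vmem (L :&: D).
  rewrite DL0 cards0 /coloured_bound /= => Cle.
  have [DL0'|[o' o'P]] := set_0Vmem (L' :&: D'); last first.
    have pos : 0 < #|L' :&: D'| by apply/card_gt0P; exists o'.
    apply: leq_trans cardC _; apply: leq_trans (_ : #|C|.+1 <= 6) _.
      by rewrite ltnS (leq_trans Cle) // geq_max /= (leq_trans sle'').
    by apply: coloured_bound_ge6.
  rewrite DL0' cards0 /=.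
  have NL1 : f1 \notin L'.
    by apply/negP=> f1L; have := in_set0 f1; rewrite -DL0' inE f1L D1.
  have NL2 : f2 \notin L'.
    by apply/negP=> f2L; have := in_set0 f2; rewrite -DL0' inE f2L D2.
  have NL1' : f1 \notin L.
    by apply: contra NL1 => f1L; apply: (subsetP sL); apply/setD1P.
  have NL2' : f2 \notin L.
    by apply: contra NL2 => f2L; apply: (subsetP sL); apply/setD1P.
  (* Still no point is dead for both coordinates: [f1] and [f2] are newly dead and at most [f3] is
     lost, so [s] grows. *)
  have sU : f1 |: (f2 |: ((L :|: D) :\ f3)) \subset L' :|: D'.
    rewrite !subUset !sub1set !in_setU D1 D2 !orbT /=.
    apply/subsetP=> f /setD1P[nf /setUP[fL|fD]]; apply/setUP.
      by left; apply: (subsetP sL); apply/setD1P.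
    by right; apply: (subsetP sD).
  have := subset_leq_card sU.
  rewrite !cardsU1 !in_setU1 !in_setD1 !in_setU (negbTE n12) (negbTE n13) (negbTE n23) /=.
  rewrite (negbTE NL1') (negbTE ND1) (negbTE NL2') (negbTE ND2) /=.
  have := cardsD1 f3 (L :|: D); move: Cle cardC.
  move: #|L :|: D| #|_ :\ f3| #|L' :|: D'| #|C| #|C'| (f3 \in _) => a b c d e [] /=; clear; lia.
(* A point [o] dead for both coordinates has [z o > z f1], hence [y o < y f1]. The coloured point
   that makes [o] dead for [y] does so for [f1] and [f2] too, and [d] grows by two. *)
case/setIP=> oL oD Cle.
have /deadP[oF [v /Cz lv ltv]] := oD.
have /deadP[_ [v' v'C ltv']] := oL.
have yo : y o < y f1.
  rewrite ltnNge; apply/negP => le.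
  have e : f1 = o by apply: anti => //; rewrite ltnW // (ltn_trans lv ltv).
  by move: (ltn_trans lv ltv); rewrite -e ltnn.
have v'C' : v' \in C' by apply: (subsetP sC).
have L1 : f1 \in L' by apply/deadP; split=> //; exists v' => //; apply: ltn_trans yo.
have L2 : f2 \in L' by apply/deadP; split=> //; exists v' => //; apply: ltn_trans y12; apply: ltn_trans yo.
have sI : f1 |: (f2 |: (L :&: D)) \subset L' :&: D'.
  rewrite !subUset !sub1set !in_setI L1 L2 D1 D2 /=; apply/subsetP=> f /setIP[fL fD].
  rewrite in_setI (subsetP sD) // andbT; apply: (subsetP sL); apply/setD1P; split=> //.
  by apply: contraTneq fD => ->.
(* With [#|F| <= 5] this leaves [d <= 2] before the step, where the bound is 6. *)
have sI' : f3 |: (f1 |: (f2 |: (L :&: D))) \subset F.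
  rewrite !subUset !sub1set F1 F2 F3 /=; apply/subsetP=> f /setIP[fL _].
  exact: (subsetP (dead_sub y F C)).
have pos : 0 < #|L :&: D| by apply/card_gt0P; exists o; apply/setIP.
apply: leq_trans cardC _; move: Cle (subset_leq_card sI) (subset_leq_card sI').
rewrite !cardsU1 !in_setU1 !in_setI (negbTE n12) eq_sym (negbTE n13) [f3 == _]eq_sym (negbTE n23).
rewrite (negbTE ND1) (negbTE ND2) (negbTE ND3) !andbF /=.
move: pos F5.
move: #|L :&: D| #|L :|: D| #|L' :&: D'| #|L' :|: D'| #|C| #|F| => a b c d e h; clear.
rewrite /coloured_bound; case: (a =P 0) => [|_]; first by lia.
by case: (c =P 0); case: (leqP a 2); case: (leqP c 2) => *; lia.
Qed.

End DeadFrees.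

(** * Two-colouring by arrivals *)

Section Colouring.
Variables (T : finType) (y z : T -> nat).
Implicit Types (A : {set T}) (c : T -> option bool) (s : seq T).

Definition wedge A Y Z := [set p in A | (y p < Y) && (z p < Z)].

Definition below q p := (y q <= y p) && (z q <= z p).

Definition minimal A p := [forall q in A, below q p ==> (q == p)].

(* A killed point is uncoloured but dominates a later point; it eventually gets
   the colour opposite to that of the point that killed it. *)
Definition killed A c := [set p in A | (c p == None) && ~~ minimal A p].

(** Only these wedges can still end monochromatic: every wedge containing a killed point also
    contains its killer, of the opposite colour. *)
Definition alive A c Y Z :=
  [disjoint wedge A Y Z & killed A c] /\
  {in wedge A Y Z &, forall p q, c p != None -> c q != None -> c p = c q}.

Definition frees A c Y Z := [set p in wedge A Y Z | c p == None].

Definition coloured A c Y Z := [set p in wedge A Y Z | c p != None].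

(** The invariant of the construction: [K = 4] between arrivals, [K = 5] right after one. *)
Definition sparse K A c := forall Y Z, alive A c Y Z ->
  #|frees A c Y Z| <= K /\ few_coloured y z (frees A c Y Z) (coloured A c Y Z).

Lemma minimalP A p :
  reflect {in A, forall q, below q p -> q = p} (minimal A p).
Proof.
apply: (iffP forall_inP) => h q qA; first by move=> /(implyP (h q qA))/eqP.
by apply/implyP => /(h q qA) ->.
Qed.

Lemma wedgeP A Y Z p :
  reflect [/\ p \in A, y p < Y & z p < Z] (p \in wedge A Y Z).
Proof. by rewrite inE; apply: and3P. Qed.

Lemma alive_minimal A c Y Z p :
  alive A c Y Z -> p \in wedge A Y Z -> c p = None -> minimal A p.
Proof.
case=> dis _ pW cp; have /wedgeP[pA _ _] := pW.
by have := disjointFr dis pW; rewrite inE pA cp => /negbFE.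
Qed.

Lemma frees_antichain A c Y Z : alive A c Y Z ->
  {in frees A c Y Z &, forall f g, y f <= y g -> z f <= z g -> f = g}.
Proof.
move=> al f g /setIdP[/wedgeP[fA _ _] _] /setIdP[gW /eqP cg] yfg zfg.
by have /minimalP := alive_minimal al gW cg; apply=> //; apply/andP.
Qed.

Definition recolour c p b := fun q => if q == p then Some b else c q.

Lemma killed_recolour A c p b : minimal A p -> killed A (recolour c p b) = killed A c.
Proof.
move=> mp; apply/setP=> q; rewrite !inE /recolour.
by have [->|_] := eqVneq q p; rewrite ?mp ?andbF.
Qed.

(** Colouring a minimal point cannot revive a wedge: the killed set is unchanged and one more colour
    has to agree. *)
Lemma alive_recolour A c p b Y Z : minimal A p -> c p = None ->
  alive A (recolour c p b) Y Z -> alive A c Y Z.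
Proof.
move=> mp cp [dis mono]; split; first by rewrite -(killed_recolour c b mp).
move=> q r qW rW cq cr; have := mono q r qW rW; rewrite /recolour.
have [eq|_] := eqVneq q p; first by rewrite eq cp in cq.
have [er|_] := eqVneq r p; first by rewrite er cp in cr.
exact.
Qed.

Lemma few_coloured1 (F C : {set T}) : #|C| <= 1 -> few_coloured y z F C.
Proof.
move=> C1; apply: leq_trans C1 _; rewrite /coloured_bound.
by case: ifP => _; [rewrite leq_maxl | case: ifP].
Qed.

(* If a wedge (Y, Z) containing f3 stays alive, its coloured points lie outside
   the wedge (Y', Z').  If Y <= Y', all of them have z >= Z', so that f1 and f2
   lie in the wedge (Y, Z) and become dead for z; the case Z <= Z' is symmetric. *)
Lemma sparse_colour_middle A c Y' Z' b f1 f2 f3 f4 f5 :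
  sparse 5 A c -> alive A c Y' Z' ->
  {subset [:: f1; f2; f3; f4; f5] <= frees A c Y' Z'} ->
  [&& y f1 < y f2, y f2 < y f3, y f3 < y f4 & y f4 < y f5] ->
  [&& z f5 < z f4, z f4 < z f3, z f3 < z f2 & z f2 < z f1] ->
  (forall Y Z, alive A c Y Z -> wedge A Y' Z' \subset wedge A Y Z ->
     {in wedge A Y Z, forall v, c v != Some b}) ->
  sparse 5 A (recolour c f3 b).
Proof.
move=> sp al' sub /and4P[y12 y23 y34 y45] /and4P[z54 z43 z32 z21] nob Y Z al.
have fr f : f \in [:: f1; f2; f3; f4; f5] -> [/\ f \in A, y f < Y', z f < Z' & c f = None].
  by move=> /sub/setIdP[/wedgeP[? ? ?] /eqP ?].
have [A1 Y1 Z1 c1] := fr f1 (mem_head _ _).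
have [A2 Y2 Z2 c2] : [/\ f2 \in A, y f2 < Y', z f2 < Z' & c f2 = None].
  by apply: fr; rewrite !inE eqxx ?orbT.
have [A3 Y3 Z3 c3] : [/\ f3 \in A, y f3 < Y', z f3 < Z' & c f3 = None].
  by apply: fr; rewrite !inE eqxx ?orbT.
have [A4 Y4 Z4 c4] : [/\ f4 \in A, y f4 < Y', z f4 < Z' & c f4 = None].
  by apply: fr; rewrite !inE eqxx ?orbT.
have [A5 Y5 Z5 c5] : [/\ f5 \in A, y f5 < Y', z f5 < Z' & c f5 = None].
  by apply: fr; rewrite !inE eqxx ?orbT.
have W3 : f3 \in wedge A Y' Z' by apply/wedgeP.
have m3 := alive_minimal al' W3 c3.
have alc := alive_recolour m3 c3 al.
have [F5 few] := sp _ _ alc.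
have eF : frees A (recolour c f3 b) Y Z = frees A c Y Z :\ f3.
  apply/setP=> q; rewrite in_setD1 !in_set /recolour.
  by have [->|_] := eqVneq q f3; rewrite ?andbF.
have [f3W|f3W] := boolP (f3 \in wedge A Y Z); last first.
  suff [-> ->] : frees A (recolour c f3 b) Y Z = frees A c Y Z /\
      coloured A (recolour c f3 b) Y Z = coloured A c Y Z by [].
  move: f3W; rewrite in_set => f3W; split; apply/setP=> q; rewrite !in_set /recolour.
    by have [->|_] := eqVneq q f3; rewrite ?(negbTE f3W).
  by have [->|_] := eqVneq q f3; rewrite ?(negbTE f3W).
have eC : coloured A (recolour c f3 b) Y Z = f3 |: coloured A c Y Z.
  apply/setP=> q; rewrite in_setU1 !in_set /recolour.
  have [->|_] := eqVneq q f3; last by [].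
  by move/wedgeP: f3W => [-> -> ->].
rewrite eF eC; split; first by apply: leq_trans F5; rewrite subset_leq_card // subsetDl.
have [C0|[v0 v0C]] := set_0Vmem (coloured A c Y Z).
  by apply: few_coloured1; rewrite C0 setU0 cards1.
have colb v : v \in coloured A c Y Z -> c v = Some b.
  move=> /setIdP[vW cv]; have := al.2 v f3 vW f3W; rewrite /recolour eqxx.
  by have [ev|_ ->] := eqVneq v f3; first by rewrite ev c3 in cv.
have out v : v \in coloured A c Y Z -> [/\ y v < Y, z v < Z & (Y' <= y v) || (Z' <= z v)].
  move=> vC; have /setIdP[/wedgeP[vA vY vZ] _] := vC; split=> //.
  have := nob _ _ al' (subxx _) v; rewrite colb // eqxx => h.
  apply/norP; case; rewrite -!ltnNge => vY' vZ'.
  by have : false by apply: h; apply/wedgeP.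
have [yv0 zv0 o0] := out _ v0C; have /wedgeP[_ y3 z3] := f3W.
have anti := frees_antichain alc.
have y13 := ltn_trans y12 y23; have z53 := ltn_trans z54 z43.
have [leY|gtY] := leqP Y Y'.
  have zC v : v \in coloured A c Y Z -> Z' <= z v.
    by case/out=> vY _; rewrite leqNgt (leq_trans vY leY).
  have zv := zC _ v0C.
  apply: (@few_coloured_step _ _ _ _ _ f1 f2 f3) => //.
  - by apply/setIdP; rewrite c1; split=> //; apply/wedgeP; split=> //;
      [apply: ltn_trans y3 | apply: ltn_trans zv0; apply: leq_trans zv].
  - by apply/setIdP; rewrite c2; split=> //; apply/wedgeP; split=> //;
      [apply: ltn_trans y3 | apply: ltn_trans zv0; apply: leq_trans zv].
  - by apply/setIdP; rewrite c3.
  - by rewrite y12.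
  - by rewrite z32.
  - by move=> v /zC; apply: leq_trans.
have [leZ|gtZ] := leqP Z Z'.
  have yC v : v \in coloured A c Y Z -> Y' <= y v.
    by case/out=> _ vZ; rewrite [Z' <= _]leqNgt (leq_trans vZ leZ) orbF.
  have yv := yC _ v0C.
  rewrite few_colouredC; apply: (@few_coloured_step _ _ _ _ _ f5 f4 f3) => //.
  - by move=> f g fF gF zfg yfg; apply: anti.
  - by apply/setIdP; rewrite c5; split=> //; apply/wedgeP; split=> //;
      [apply: ltn_trans yv0; apply: leq_trans yv | apply: ltn_trans z3].
  - by apply/setIdP; rewrite c4; split=> //; apply/wedgeP; split=> //;
      [apply: ltn_trans yv0; apply: leq_trans yv | apply: ltn_trans z3].
  - by apply/setIdP; rewrite c3.
  - by rewrite z54.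
  - by rewrite y34.
  - by move=> v /yC; apply: leq_trans.
  - by rewrite few_colouredC.
(* Otherwise the wedge contains [(Y', Z')], and the choice of [b] excludes points of colour [b] such
   as [v0]. *)
have sW : wedge A Y' Z' \subset wedge A Y Z.
  apply/subsetP=> q /wedgeP[qA qY qZ]; apply/wedgeP; split=> //.
    exact: ltn_trans qY gtY.
  exact: ltn_trans qZ gtZ.
have /setIdP[v0W _] := v0C.
by have := nob _ _ alc sW _ v0W; rewrite colb // eqxx.
Qed.

Lemma five_frees A c Y Z : alive A c Y Z -> 4 < #|frees A c Y Z| ->
  exists f1 f2 f3 f4 f5,
  [/\ {subset [:: f1; f2; f3; f4; f5] <= frees A c Y Z},
      [&& y f1 < y f2, y f2 < y f3, y f3 < y f4 & y f4 < y f5] &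
      [&& z f5 < z f4, z f4 < z f3, z f3 < z f2 & z f2 < z f1]].
Proof.
move=> al; pose s := sort (relpre y leq) (enum (frees A c Y Z)).
have us : uniq s by rewrite sort_uniq enum_uniq.
have ss : sorted (relpre y leq) s by apply: sort_sorted => f g; apply: leq_total.
have ms f : (f \in s) = (f \in frees A c Y Z) by rewrite mem_sort mem_enum.
rewrite cardE -(size_sort (relpre y leq)) -/s.
move: us ss ms; case: s => [|f1 [|f2 [|f3 [|f4 [|f5 s]]]]] //= us ss ms _.
exists f1, f2, f3, f4, f5.
have sub : {subset [:: f1; f2; f3; f4; f5] <= frees A c Y Z}.
  by move=> f; rewrite -ms !inE => /or4P[|||/orP[|]] ->; rewrite ?orbT.
have step f g : f \in [:: f1; f2; f3; f4; f5] -> g \in [:: f1; f2; f3; f4; f5] ->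
    f != g -> y f <= y g -> (y f < y g) && (z g < z f).
  move=> /sub fF /sub gF nfg yfg; have anti := frees_antichain al.
  have zfg : z g < z f by rewrite ltnNge; apply: contra nfg => le; apply/eqP/anti.
  rewrite zfg andbT ltnNge; apply: contra nfg => le; rewrite eq_sym; apply/eqP/anti => //.
  exact: ltnW.
move: us ss; rewrite !inE !negb_or.
move=> /and5P[/and5P[n12 _ _ _ _] /and4P[n23 _ _ _] /and3P[n34 _ _] /andP[n45 _] _].
move=> /and5P[y12 y23 y34 y45 _].
have /andP[-> ->] : (y f1 < y f2) && (z f2 < z f1) by apply: step; rewrite ?inE ?eqxx ?orbT.
have /andP[-> ->] : (y f2 < y f3) && (z f3 < z f2) by apply: step; rewrite ?inE ?eqxx ?orbT.
have /andP[-> ->] : (y f3 < y f4) && (z f4 < z f3) by apply: step; rewrite ?inE ?eqxx ?orbT.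
have /andP[-> ->] : (y f4 < y f5) && (z f5 < z f4) by apply: step; rewrite ?inE ?eqxx ?orbT.
by [].
Qed.

(** Each round colours one more point of [A], so the process ends. *)
Lemma sparse_repair A c : sparse 5 A c ->
  exists c', [/\ sparse 4 A c', killed A c' = killed A c,
    (forall p, c p != None -> c' p = c p) & (forall p, p \notin A -> c' p = c p)].
Proof.
have [n] := ubnP #|[set p in A | c p == None]|; elim: n c => // n IH c lt sp.
have [[Y0 [Z0 [al0 lt0]]]|none] := EM (exists Y Z, alive A c Y Z /\ 4 < #|frees A c Y Z|);
  last first.
  exists c; split=> // Y Z al; have [_ few] := sp _ _ al; split=> //.
  by rewrite leqNgt; apply/negP => h; apply: none; exists Y, Z.
have [f1 [f2 [f3 [f4 [f5 [sub0 ys zs]]]]]] := five_frees al0 lt0.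
(* If some alive wedge around the current one has a coloured point, pass to it: all its alive
   extensions share that colour, and [b] is the opposite. If none has, any [b] will do. *)
have [Y' [Z' [b [al' sub' nob]]]] : exists Y' Z' b, [/\ alive A c Y' Z',
    wedge A Y0 Z0 \subset wedge A Y' Z' &
    forall Y Z, alive A c Y Z -> wedge A Y' Z' \subset wedge A Y Z ->
     {in wedge A Y Z, forall v, c v != Some b}].
  have [[Y' [Z' [v [al' sub' vW vc]]]]|none] := EM (exists Y' Z' v, [/\ alive A c Y' Z',
    wedge A Y0 Z0 \subset wedge A Y' Z', v \in wedge A Y' Z' & c v != None]).
    case cv: (c v) vc => [x|] // _; exists Y', Z', (~~ x); split=> // Y Z al sub w wW.
    apply/eqP => cw; have := al.2 v w (subsetP sub _ vW) wW.
    by rewrite cv cw => /(_ isT isT) []; case: x {cv cw}.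
  exists Y0, Z0, true; split=> // Y Z al sub w wW; apply/eqP => cw.
  by apply: none; exists Y, Z, w; rewrite cw; split.
have sub : {subset [:: f1; f2; f3; f4; f5] <= frees A c Y' Z'}.
  by move=> f /sub0/setIdP[/(subsetP sub') fW cf]; apply/setIdP.
have /setIdP[f3W /eqP c3] : f3 \in frees A c Y' Z' by apply: sub; rewrite !inE eqxx !orbT.
have m3 := alive_minimal al' f3W c3.
have /IH : sparse 5 A (recolour c f3 b) by apply: sparse_colour_middle sub ys zs nob.
case.
  have /wedgeP[A3 _ _] := f3W; move: lt; rewrite ltnS; apply: leq_trans.
  apply: proper_card; apply/properP; split.
    by apply/subsetP=> q; rewrite !inE /recolour; case: (q =P f3) => [_|_]; rewrite ?andbF.
  by exists f3; rewrite !inE ?A3 ?c3 // /recolour eqxx andbF.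
move=> c' [sp' kc' ext out]; exists c'; split=> //.
- by rewrite kc' killed_recolour.
- move=> p cp; have np : p != f3 by apply: contraNneq cp => ->; rewrite c3.
  by rewrite ext /recolour (negbTE np).
- move=> p pA; rewrite out // /recolour; case: eqP => // e.
  by move/wedgeP: f3W; rewrite -e (negbTE pA) => -[].
Qed.

(** No earlier point is below an arriving one, which is therefore minimal on arrival. *)
Fixpoint admissible A s :=
  if s is p :: s' then [forall q in A, ~~ below q p] && admissible (p |: A) s'
  else true.

(** Killed points stay killed, so a wedge alive after the arrival was alive before; it gains at most
    the uncoloured point [p]. *)
Lemma sparse_arrival A c p : sparse 4 A c -> p \notin A -> c p = None ->
  sparse 5 (p |: A) c.
Proof.
move=> sp pA cp Y Z [dis mono].
have sW : wedge A Y Z \subset wedge (p |: A) Y Z.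
  by apply/subsetP=> q /wedgeP[qA qY qZ]; apply/wedgeP; split=> //; rewrite in_setU1 qA orbT.
have [] := sp Y Z.
  split; last by move=> q r qW rW; apply: mono; apply: (subsetP sW).
  apply/pred0P=> q /=; apply/negbTE/negP => /andP[qW].
  rewrite in_set => /and3P[qA cq mq]; have := disjointFr dis (subsetP sW _ qW).
  rewrite in_set in_setU1 qA orbT cq /= => /negbFE/minimalP mq'.
  by case/negP: mq; apply/minimalP=> r rA; apply: mq'; rewrite in_setU1 rA orbT.
have eC : coloured (p |: A) c Y Z = coloured A c Y Z.
  apply/setP=> q; rewrite !in_set in_set1; have [->|//] := eqVneq q p.
  by rewrite cp !andbF.
have sF : frees A c Y Z \subset frees (p |: A) c Y Z.
  apply/subsetP=> q; rewrite !in_set => /andP[/andP[-> ->] ->].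
  by rewrite orbT.
have sF' : frees (p |: A) c Y Z \subset p |: frees A c Y Z.
  apply/subsetP=> q; rewrite !in_set in_set1.
  by case: (q == p).
rewrite eC => F4 few; split; last by apply: few_coloured_more_free few => //; apply: leq_trans F4 _.
apply: leq_trans (subset_leq_card sF') _; rewrite cardsU1.
by case: (_ \notin _); rewrite ?add0n ?add1n // (leq_trans F4).
Qed.

(* Wedges meeting the killed set are excluded because the colour of a killed
   point is only fixed when the colour of its killer is known, that is, outside
   this induction. *)
Lemma colour_arrivals s A c : sparse 4 A c -> admissible A s -> uniq s ->
  {in s, forall p, p \notin A} -> (forall p, p \notin A -> c p = None) ->
  exists f : T -> bool,
    (forall p b, c p = Some b -> f p = b) /\
    forall n Y Z b, let W := wedge (A :|: [set p in take n s]) Y Z in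
      [disjoint W & killed A c] -> {in W, forall p, f p = b} -> #|W| <= 11.
Proof.
(* A monochromatic wedge without killed points is alive, so it has at most 4 + 7 points. *)
have now A' c' (f : T -> bool) Y Z b : sparse 4 A' c' ->
    (forall p b, c' p = Some b -> f p = b) ->
    [disjoint wedge A' Y Z & killed A' c'] -> {in wedge A' Y Z, forall p, f p = b} ->
    #|wedge A' Y Z| <= 11.
  move=> sp ext dis mono; have [|F4 few] := sp Y Z.
    split=> // p q pW qW; case cp: (c' p) => [x|] //; case cq: (c' q) => [x'|] // _ _.
    by rewrite -(ext _ _ cp) -(ext _ _ cq) !mono.
  have : #|coloured A' c' Y Z| <= 7.
    by apply: few_coloured_le7 few; apply: leq_trans F4 _.
  have <- : frees A' c' Y Z :|: coloured A' c' Y Z = wedge A' Y Z.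
    by apply/setP=> q; rewrite !in_set; case: (c' q == None); rewrite /= ?andbT ?andbF ?orbF.
  by move=> C7; apply: leq_trans (leq_card_setU _ _) _; rewrite -[11]/(4 + 7) leq_add.
elim: s A c => [|p s IH] A c sp adm us sA cN.
  exists (fun p => if c p is Some b then b else false); split=> [p b -> //|n Y Z b].
  rewrite /= [X in A :|: X](_ : _ = set0) ?setU0; last by apply/setP=> q; rewrite !inE.
  by apply: (now A c) => // q b' ->.
have pA : p \notin A by apply: sA; rewrite mem_head.
have /andP[/forall_inP pnew adm'] := adm; have /andP[ps us'] := us.
have cp := cN _ pA.
have [c' [sp' kc' ext' out']] := sparse_repair (sparse_arrival sp pA cp).
have [||f [fext ff]] := IH (p |: A) c' sp' adm' us'.
- move=> q qs; rewrite in_setU1 negb_or sA ?inE ?qs ?orbT // andbT.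
  by apply: contraNneq ps => <-.
- by move=> q qA; rewrite out' // cN //; apply: contra qA; rewrite in_setU1 => ->; rewrite orbT.
(* The colouring [f] from the later arrivals already fixes the colour of [p]. Points killed by [p]
   get the opposite one; those killed before are left to earlier arrivals. *)
pose g q := if q \in killed (p |: A) c then
              (if q \in killed A c then f q else ~~ f p) else f q.
have mp : minimal (p |: A) p.
  apply/minimalP=> q; rewrite in_setU1 => /orP[/eqP-> //|/pnew/negbTE h].
  by rewrite h.
have npk : p \notin killed (p |: A) c by rewrite in_set mp !andbF.
have gp : g p = f p by rewrite /g (negbTE npk).
exists g; split=> [q b cq|].
  have cq' : c q != None by rewrite cq.
  by rewrite /g in_set (negbTE cq') andbF; apply: fext; rewrite ext'.
move=> [|n] Y Z b.
  rewrite /= [X in A :|: X](_ : _ = set0) ?setU0; last by apply/setP=> q; rewrite !inE.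
  apply: (now A c) => // q b' cq; have cq' : c q != None by rewrite cq.
  by rewrite /g in_set (negbTE cq') andbF; apply: fext; rewrite ext'.
rewrite /=; have -> : A :|: [set q in p :: take n s] = (p |: A) :|: [set q in take n s].
  by apply/setP=> q; rewrite !inE; case: (q == p); rewrite ?orbT.
set W := wedge _ Y Z => dis mono.
(* A point killed by [p] would bring [p], of the other colour, into the monochromatic [W]. *)
have disW : [disjoint W & killed (p |: A) c].
  apply/pred0P=> q /=; apply/negbTE/negP => /andP[qW qk].
  have nk := disjointFr dis qW; have gq := mono _ qW.
  rewrite /g qk nk in gq.
  have := qk; rewrite in_set => /and3P[+ cq /minimalP mq].
  rewrite in_setU1 => /orP[/eqP eq|qA]; first by rewrite eq (negbTE npk) in qk.
  have /minimalP mqA : minimal A q.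
    by apply: contraFT nk => mqA; rewrite in_set qA cq.
  apply: mq => r; rewrite in_setU1 => /orP[/eqP-> le|/mqA//].
  have /wedgeP[_ qY qZ] := qW; have /andP[yle zle] := le.
  have pW : p \in W.
    apply/wedgeP; rewrite in_setU in_setU1 eqxx; split=> //.
      exact: leq_ltn_trans qY.
    exact: leq_ltn_trans qZ.
  by have := mono _ pW; rewrite gp -gq; case: (f p).
apply: (ff n Y Z b); first by rewrite kc'.
by move=> q qW; rewrite -(mono _ qW) /g (disjointFr disW qW).
Qed.

End Colouring.

(** * Two-colouring for octants *)

Definition octant (T : finType) (x y z : T -> nat) (S : {set T}) X Y Z :=
  [set p in S | [&& x p < X, y p < Y & z p < Z]].

Definition octant_antichain (T : finType) (x y z : T -> nat) (S : {set T}) :=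
  {in S &, forall p q, x p <= x q -> y p <= y q -> z p <= z q -> p = q}.

Lemma octant_two_colouring (T : finType) (x y z : T -> nat) (S : {set T}) :
  octant_antichain x y z S ->
  exists f : T -> bool, forall X Y Z b,
    {in octant x y z S X Y Z, forall p, f p = b} -> #|octant x y z S X Y Z| <= 11.
Proof.
move=> anti; pose s := sort (relpre x leq) (enum S).
have us : uniq s by rewrite sort_uniq enum_uniq.
have ss : sorted (relpre x leq) s by apply: sort_sorted => f g; apply: leq_total.
have xtr : transitive (relpre x leq) by move=> a b c; apply: leq_trans.
have ms p : (p \in s) = (p \in S) by rewrite mem_sort mem_enum.
have adm : admissible y z set0 s.
  have : forall q p, q \in (set0 : {set T}) -> p \in s -> [&& q \in S, q != p & x q <= x p].
    by move=> q p; rewrite inE.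
  have sS : {subset s <= S} by move=> p; rewrite ms.
  move: us ss sS; clear ms; elim: (s) set0 => //= p s' IH A /andP[ps us] ss sS hA.
  apply/andP; split.
    apply/forall_inP=> q qA; apply/negP => /andP[yle zle].
    have /and3P[qS /eqP ne xle] := hA q p qA (mem_head _ _).
    by apply: ne; apply: anti => //; apply: sS; rewrite mem_head.
  apply: IH => //; first exact: path_sorted ss.
    by move=> r rs; apply: sS; rewrite inE rs orbT.
  move=> q r; rewrite in_setU1 => /orP[/eqP->|qA] rs; last by apply: hA; rewrite // inE rs orbT.
  have := allP (order_path_min xtr ss) r rs => /= ->.
  rewrite andbT sS ?mem_head //=.
  by apply: contraNneq ps => ->.
have [|||f [_ ff]] := @colour_arrivals T y z s set0 (fun=> None) _ adm us.
- move=> Y Z _; have e : wedge y z set0 Y Z = set0 by apply/setP=> q; rewrite !inE.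
  have -> : frees y z set0 (fun=> None) Y Z = set0 by apply/setP=> q; rewrite !inE.
  have -> : coloured y z set0 (fun=> None) Y Z = set0 by apply/setP=> q; rewrite !inE.
  by rewrite cards0; split=> //; apply: few_coloured1; rewrite cards0.
- by move=> p _; rewrite inE.
- by [].
(* As [s] is sorted by [x], its first [n] points are exactly those with [x < X]. *)
exists f => X Y Z b mono; set n := find (fun p => X <= x p) s.
have eW : octant x y z S X Y Z = wedge y z (set0 :|: [set p in take n s]) Y Z.
  rewrite set0U; apply/setP=> p; rewrite !inE andbA; congr (_ && _).
  apply/andP/idP => [[pS lt]|pt].
    have := ms p; rewrite pS -{1}(cat_take_drop n s) mem_cat => /orP[//|pd].
    have : has (fun p => X <= x p) s.
      rewrite has_find -/n ltnNge; apply/negP => le.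
      by rewrite drop_oversize in pd.
    move=> hs; have := nth_find p hs; rewrite -/n => h.
    have nlt : n < size s by rewrite -has_find.
    have := ss; rewrite -(cat_take_drop n s) => /cat_sorted2[_].
    rewrite (drop_nth p nlt) => /(order_path_min xtr)/allP al.
    move: pd; rewrite (drop_nth p nlt) inE => /orP[/eqP e|/al /= le].
      by move: h; rewrite -e leqNgt lt.
    by move: lt; rewrite ltnNge (leq_trans h le).
  split; first by rewrite -ms; apply: mem_take pt.
  rewrite ltnNge; apply/negP => le.
  have := @before_find _ p (fun p => X <= x p) s (index p s).
  have ps := mem_take pt.
  have lti : index p s < n by rewrite -(in_take n ps).
  by rewrite nth_index // le => /(_ lti).
rewrite eW; apply: (ff n Y Z b); rewrite -?eW //.
by apply/pred0P=> q /=; rewrite [q \in killed _ _ _ _]in_set in_set0 andbF.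
Qed.

(** * Covering by octants *)

Section Cover.
Variables (T : finType) (x y z : T -> nat).

Definition in_octant (d : nat * nat * nat) p :=
  [&& x p < d.1.1, y p < d.1.2 & z p < d.2].

Lemma foldr_minn_le (a : nat) s : foldr minn a s <= a.
Proof. by elim: s => //= b s; apply: leq_trans (geq_minr _ _). Qed.

Lemma foldr_minn_mem (a : nat) s t : t \in s -> foldr minn a s <= t.
Proof.
elim: s => //= b s IH; rewrite inE => /orP[/eqP->|/IH]; first exact: geq_minl.
by apply: leq_trans (geq_minr _ _).
Qed.

Lemma foldr_minn_gt (a : nat) s t :
  t < a -> {in s, forall b, t < b} -> t < foldr minn a s.
Proof.
move=> ta; elim: s => //= b s IH h; rewrite leq_min h ?mem_head //=.
by apply: IH => c cs; apply: h; rewrite inE cs orbT.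
Qed.

(* Adding b, the point with the largest x so far: an octant containing b is cut at
   x < x b, and the part of it beyond is covered by two new octants, whose
   bounds zeta and eta are those of the staircase of s next to b. *)
Lemma octant_cover s X Y Z : sorted (fun p q => x q <= x p) s ->
  exists D : seq (nat * nat * nat),
  [/\ size D = (size s).*2.+1,
      {in D, forall d p, in_octant d p -> in_octant (X, Y, Z) p},
      {in D, forall d, {in s, forall b, ~~ in_octant d b}} &
      forall p, in_octant (X, Y, Z) p ->
        {in s, forall b, ~~ [&& x b <= x p, y b <= y p & z b <= z p]} ->
        exists2 d, d \in D & in_octant d p].
Proof.
elim: s => [_|b s IH ss].
  exists [:: (X, Y, Z)]; split=> //; first by move=> d; rewrite inE => /eqP->.
  by move=> p pO _; exists (X, Y, Z); rewrite ?mem_head.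
have [D [szD subD avD covD]] := IH (path_sorted ss).
have xtr : transitive (fun p q : T => x q <= x p).
  by move=> q p r h1 h2; apply: leq_trans h2 h1.
have xs : {in s, forall b', x b' <= x b}.
  by move=> b' b's; have := allP (order_path_min xtr ss) _ b's.
pose cut d := if in_octant d b then (x b, d.1.2, d.2) else d.
pose zeta := foldr minn Z [seq z b' | b' <- s & y b' < y b].
pose eta := foldr minn Y [seq y b' | b' <- s & z b' < z b].
pose n1 := (X, minn Y (y b), zeta); pose n2 := (X, eta, minn Z (z b)).
have cut_sub d p : in_octant (cut d) p -> in_octant d p.
  rewrite /cut; case: ifP => // /and3P[xb _ _] /and3P[/= xp yp zp].
  by apply/and3P; split=> //; apply: ltn_trans xb.
exists (n1 :: n2 :: map cut D); split.
- by rewrite /= size_map szD doubleS.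
- move=> d; rewrite !inE => /or3P[/eqP->|/eqP->|/mapP[d' d'D ->]] p.
  + move=> /and3P[/= xp]; rewrite leq_min => /andP[yp _] zp; apply/and3P; split=> //=.
    by apply: leq_trans zp _; apply: foldr_minn_le.
  + move=> /and3P[/= xp yp]; rewrite leq_min => /andP[zp _]; apply/and3P; split=> //=.
    by apply: leq_trans yp _; apply: foldr_minn_le.
  + by move=> /cut_sub; apply: subD.
- move=> d; rewrite !inE => /or3P[/eqP->|/eqP->|/mapP[d' d'D ->]] b'.
  + rewrite inE => /orP[/eqP->|b's]; apply/negP => /and3P[/= _]; rewrite leq_min.
      by rewrite ltnn andbF.
    move=> /andP[_ yb] zb; have : zeta <= z b' by apply: foldr_minn_mem; rewrite map_f // mem_filter yb.
    by rewrite leqNgt zb.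
  + rewrite inE => /orP[/eqP->|b's]; apply/negP => /and3P[/= _ yb]; rewrite leq_min.
      by rewrite ltnn andbF.
    move=> /andP[_ zb]; have : eta <= y b' by apply: foldr_minn_mem; rewrite map_f // mem_filter zb.
    by rewrite leqNgt yb.
  + rewrite inE => /orP[/eqP->|b's]; last by apply: contra (@cut_sub d' b') _; apply: avD.
    by rewrite /cut; case: ifP => [_|->] //; rewrite /in_octant /= ltnn.
move=> p pO nb.
have [|d dD pd] := covD p pO; first by move=> b' b's; apply: nb; rewrite inE b's orbT.
have [bd|bd] := boolP (in_octant d b); last first.
  by exists d => //; rewrite !inE; apply/or3P/Or33/mapP; exists d; rewrite // /cut (negbTE bd).
have [xp|xp] := ltnP (x p) (x b).
  exists (cut d); first by rewrite !inE map_f ?orbT.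
  by rewrite /cut bd; have /and3P[_ yp zp] := pd; apply/and3P.
have /and3P[pX pY pZ] := pO; have /and3P[dX dY dZ] := bd; have /and3P[_ pdY pdZ] := pd.
(* Beyond [x b] but not above [b], the point [p] has smaller [y] or smaller [z] than [b]: it falls
   into [n1] or [n2]. *)
have := nb b (mem_head _ _); rewrite xp /= negb_and -!ltnNge => /orP[yp|zp].
  exists n1; first by rewrite mem_head.
  apply/and3P; split=> //=; first by rewrite leq_min pY.
  apply: foldr_minn_gt => // _ /mapP[b' +  ->]; rewrite mem_filter => /andP[yb b's].
  rewrite ltnNge; apply/negP => zb.
  have := nb b'; rewrite inE b's orbT (leq_trans (xs _ b's) xp) zb andbT /= => /(_ isT).
  (* Otherwise [b'] would lie in [d], which avoids [s]. *)
  have := avD d dD b' b's; rewrite /in_octant (leq_ltn_trans (xs _ b's) dX).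
  by rewrite (ltn_trans yb dY) (leq_ltn_trans zb pdZ).
exists n2; first by rewrite !inE eqxx orbT.
apply/and3P; split=> //=; last by rewrite leq_min pZ.
apply: foldr_minn_gt => // _ /mapP[b' +  ->]; rewrite mem_filter => /andP[zb b's].
rewrite ltnNge; apply/negP => yb.
have := avD d dD b' b's; rewrite /in_octant (leq_ltn_trans (xs _ b's) dX).
by rewrite (ltn_trans zb dZ) (leq_ltn_trans yb pdY).
Qed.

Lemma card_cover_seq (I : eqType) (F : I -> {set T}) (D : seq I) K (A : {set T}) :
  {in D, forall d, #|F d| <= K} -> {in A, forall p, exists2 d, d \in D & p \in F d} ->
  #|A| <= K * size D.
Proof.
elim: D A => [|d D IH] A le cov.
  by rewrite muln0 leqn0 cards_eq0; apply/eqP/setP=> p; rewrite inE; apply/negP => /cov[].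
rewrite -(cardsID (F d) A) /= mulnS leq_add //.
  by apply: leq_trans (subset_leq_card (subsetIr _ _)) (le d (mem_head _ _)).
apply: IH => [e eD|p /setDP[pA pd]]; first by apply: le; rewrite inE eD orbT.
have [e] := cov p pA; rewrite inE => /orP[/eqP->|eD pe]; first by rewrite (negbTE pd).
by exists e.
Qed.

(** A class of [j] points leaves at most [11 (2j + 1)] others, so the octant has at most
    [23j + 11 < 23 (j + 1)] points. *)
Lemma octant_colour_class (S : {set T}) (f : T -> bool) m X Y Z b :
  octant_antichain x y z S ->
  (forall X Y Z b, {in octant x y z S X Y Z, forall p, f p = b} ->
     #|octant x y z S X Y Z| <= 11) ->
  23 * m <= #|octant x y z S X Y Z| ->
  m <= #|[set p in octant x y z S X Y Z | f p == b]|.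
Proof.
move=> anti mono; set O := octant x y z S X Y Z; set Bb := [set p in O | _] => big.
pose s := sort (fun p q => x q <= x p) (enum Bb).
have ss : sorted (fun p q => x q <= x p) s.
  by apply: sort_sorted => p q; apply: leq_total.
have ms p : (p \in s) = (p \in Bb) by rewrite mem_sort mem_enum.
have [D [szD subD avD covD]] := octant_cover X Y Z ss.
have szs : size s = #|Bb| by rewrite size_sort -cardE.
have cR : #|O :\: Bb| <= 11 * size D.
  apply: (@card_cover_seq _ (fun d => octant x y z S d.1.1 d.1.2 d.2)).
    move=> d dD; apply: (mono _ _ _ (~~ b)) => p /setIdP[pS pd].
    have := contraL (avD d dD p) pd; rewrite ms !inE pS /= -/(in_octant (X, Y, Z) p).
    by rewrite (subD d dD p pd) /=; case: (f p); case: b {Bb s ss ms szs D szD subD avD covD dD pd}.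
  move=> p /setDP[pO pB]; have /setIdP[pS po] := pO.
  have [|d dD pd] := covD p po; last by exists d => //; rewrite inE pS.
  move=> q; rewrite ms => qB; apply: contra pB => /and3P[xq yq zq].
  have /setIdP[/setIdP[qS _] _] := qB.
  by rewrite -(anti q p).
have := cardsID Bb O; rewrite (setIidPr (_ : Bb \subset O)); last first.
  by apply/subsetP=> p /setIdP[].
move: cR big; rewrite szD szs; clear; lia.
Qed.

End Cover.

(** * Colouring octants with [k] colours *)

Definition octant_colourable m k :=
  forall (T : finType) (x y z : T -> nat) (S : {set T}), octant_antichain x y z S ->
  exists f : T -> 'I_k, forall X Y Z, m <= #|octant x y z S X Y Z| ->
    forall i, exists2 p, p \in octant x y z S X Y Z & f p = i.

Lemma octant_colourable1 : octant_colourable 1 1.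
Proof.
move=> T x y z S _; exists (fun=> ord0) => X Y Z /card_gt0P[p pO] i.
by exists p; rewrite ?ord1.
Qed.

Lemma octant_colourable2 : octant_colourable 12 2.
Proof.
move=> T x y z S anti; have [f fP] := octant_two_colouring anti.
exists (fun p => inord (f p)) => X Y Z big i.
have [[p pO fp]|none] := pselect (exists2 p, p \in octant x y z S X Y Z & f p = (i == 1 :> nat)).
  exists p => //; apply/val_inj; rewrite /= fp inordK; last by case: (_ == _).
  by case: i {fp} => -[|[|]].
have : #|octant x y z S X Y Z| <= 11.
  apply: (fP _ _ _ (i != 1 :> nat)) => p pO; apply/eqP/negPn/negP => h.
  by apply: none; exists p => //; move: h; case: (f p); case: (i == 1 :> nat).
by rewrite leqNgt big.
Qed.

Lemma octant_colourable_double m k :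
  octant_colourable m k -> octant_colourable (23 * m) (k + k).
Proof.
move=> col T x y z S anti; have [f fP] := octant_two_colouring anti.
have sub b : {subset [set p in S | f p == b] <= S} by move=> p /setIdP[].
have antiS b : octant_antichain x y z [set p in S | f p == b].
  by move=> p q /sub pS /sub qS; apply: anti.
have [g1 g1P] := col T x y z _ (antiS true).
have [g0 g0P] := col T x y z _ (antiS false).
exists (fun p => if f p then lshift k (g1 p) else rshift k (g0 p)) => X Y Z big i.
have eO b : octant x y z [set p in S | f p == b] X Y Z =
    [set p in octant x y z S X Y Z | f p == b].
  by apply/setP=> p; rewrite !inE; case: (_ == _); rewrite ?andbT ?andbF.
have cl b := octant_colour_class b anti fP big.
case: (split_ordP i) => j ->.
  have [|p] := g1P X Y Z _ j; first by rewrite eO.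
  by rewrite eO => /setIdP[pO /eqP fp] gp; exists p => //; rewrite fp gp.
have [|p] := g0P X Y Z _ j; first by rewrite eO.
by rewrite eO => /setIdP[pO /eqP fp] gp; exists p => //; rewrite fp gp.
Qed.

Lemma octant_colourable_pow2 j : octant_colourable (12 * 23 ^ j) (2 ^ j.+1).
Proof.
elim: j => [|j IH]; first exact: octant_colourable2.
by rewrite expnS mulnCA expnS mul2n -addnn; apply: octant_colourable_double.
Qed.

(** Surplus colours are merged into colour 0, the default of [inord]. *)
Lemma octant_colourable_fewer m k k' :
  0 < k <= k' -> octant_colourable m k' -> octant_colourable m k.
Proof.
case: k => // k /= le col T x y z S anti; have [f fP] := col T x y z S anti.
exists (fun p => inord (f p)) => X Y Z big i.
have [p pO fp] := fP X Y Z big (widen_ord le i).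
by exists p => //; rewrite fp inord_val.
Qed.

Require Import Defs.
From HB Require Import structures.
From mathcomp Require Import all_boot all_order all_algebra finmap.
From mathcomp Require Import all_classical all_reals all_analysis.
From mathcomp Require Import lra.

Import Order.TTheory GRing.Theory Num.Theory numFieldNormedType.Exports.

Local Open Scope classical_set_scope.
Local Open Scope ring_scope.

(** * The threshold *)

Section Threshold.
Variable R : realType.

Lemma ln2_gt0 : 0 < ln (2 : R).
Proof. by apply: ln_gt0; rewrite ltr1n. Qed.

Lemma threshold1 : threshold R 1 = 12 / 23.
Proof. by rewrite /threshold /log2 ln1 mul0r ceil0 sub0r exprN1. Qed.

(** Take logarithms in [2 ^ (n - 1) < k <= 2 ^ n]. *)
Lemma ceil_log2 k : (1 < k)%N -> Num.ceil (log2 (k%:R : R)) = up_log 2 k.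
Proof.
move=> k1; have /andP[] := up_log_bounds (isT : (1 < 2)%N) k1.
have : (0 < up_log 2 k)%N by rewrite up_log_gt0.
case: (up_log 2 k) => [//|n] _ /= lo hi.
have kpos : (k%:R : R) \is Num.pos by rewrite posrE ltr0n (ltn_trans _ k1).
have p2 i : (2 ^+ i : R) \is Num.pos by rewrite posrE exprn_gt0.
have lnp i : i%:R * ln 2 = ln (2 ^+ i : R) by rewrite lnXn // mulr_natl.
apply: ceil_def; rewrite /log2 ltr_pdivlMr ?ln2_gt0 // ler_pdivrMr ?ln2_gt0 //.
have -> : n.+1%:Z - 1 = n%:Z by rewrite -addn1 PoszD addrK.
by rewrite -!pmulrn !lnp ltr_ln ?ler_ln // -!natrX ltr_nat ler_nat lo.
Qed.

Lemma threshold_up_log k : (1 < k)%N ->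
  threshold R k = (12 * 23 ^ (up_log 2 k).-1)%:R.
Proof.
move=> k1; rewrite /threshold ceil_log2 //.
have : (0 < up_log 2 k)%N by rewrite up_log_gt0.
case: (up_log 2 k) => [//|n] _.
have -> : n.+1%:Z - 1 = n%:Z by rewrite -addn1 PoszD addrK.
by rewrite natrM natrX.
Qed.

(** Both sides are [expR (ln a * ln b / ln 2)]. *)
Lemma powR_log2C (a b : R) : 0 < a -> 0 < b -> a `^ log2 b = b `^ log2 a.
Proof.
move=> a0 b0; rewrite /powR /log2 !gt_eqF //; congr expR.
by rewrite mulrAC [RHS]mulrAC [ln b * _]mulrC.
Qed.

Lemma threshold_le k : (0 < k)%N -> threshold R k <= 12 * (k%:R : R) `^ log2 (23 : R).
Proof.
move=> k0; rewrite /threshold ler_pM2l // powR_log2C ?ltr0n //.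
rewrite -powR_intmul //; apply: ler_powR; first by rewrite ler1n.
exact/ltW/ceilB1_lt.
Qed.

Lemma log2_23_le : log2 (23 : R) <= 453 / 100.
Proof.
rewrite /log2 ler_pdivrMr ?ln2_gt0 // mulrAC ler_pdivlMr //.
rewrite mulrC !mulr_natl -!lnXn // ler_ln ?posrE ?exprn_gt0 //.
(* What remains is [23 ^ 100 <= 2 ^ 453]. *)
lra.
Qed.
End Threshold.

(** * Homothets of a triangle *)

Section Rank.
Variables (R : realType) (T : finType).
Implicit Type F : T -> R.

(** Ranks turn real coordinates into natural ones with the same order. *)
Definition rank F p := #|[set q | F q < F p]%SET|.

Lemma rank_le F p q : (rank F p <= rank F q)%N -> F p <= F q.
Proof.
apply: contraTT; rewrite -ltNge -ltnNge => lt; apply: proper_card; apply/properP; split.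
  by apply/fintype.subsetP=> r; rewrite !inE => /lt_trans; apply.
by exists q; rewrite !inE ?ltxx.
Qed.

(** Translates the closed bound of a half-plane into the strict bound of an octant. *)
Lemma rank_lt F a p : (rank F p < #|[set q | (F q <= a)%R]%SET|)%N = (F p <= a).
Proof.
have [le|lt] := leP (F p) a.
  apply: proper_card; apply/properP; split.
    by apply/fintype.subsetP=> r; rewrite !inE => /ltW/le_trans; apply.
  by exists p; rewrite !inE ?ltxx.
apply/negbTE; rewrite -leqNgt subset_leq_card //.
by apply/fintype.subsetP=> r; rewrite !inE => /le_lt_trans; apply.
Qed.

End Rank.

Section Triangle.
Variables (R : realType) (a b c : 'rV[R]_2).
Hypothesis free_bc : free [:: b - a; c - a].

Let X := [tuple b - a; c - a].
Let cb (p : 'rV[R]_2) : R := coord X ord0 p.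
Let cc (p : 'rV[R]_2) : R := coord X ord_max p.

Lemma coord2E p : p = cb p *: (b - a) + cc p *: (c - a).
Proof.
have XT : <<X>>%VS = fullv.
  apply/eqP; rewrite eqEdim subvf /= dimvf /dim /= mul1n.
  by have := free_bc; rewrite /free => /eqP ->.
have pX : p \in <<X>>%VS by rewrite XT memvf.
rewrite {1}(coord_span pX) !big_ord_recl big_ord0 addr0 /=.
by congr (_ + coord _ _ _ *: _); apply: val_inj.
Qed.

Lemma coord2_bc : [/\ cb (b - a) = 1, cb (c - a) = 0, cc (b - a) = 0 & cc (c - a) = 1].
Proof.
have h i j := coord_free (X := X) i j free_bc.
by split; [exact: (h ord0 ord0)|exact: (h ord_max ord0)|
           exact: (h ord0 ord_max)|exact: (h ord_max ord_max)].
Qed.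

Lemma coord2_conv (t : R) (p q : 'rV[R]_2) :
  let r := t *: p + (1 - t) *: q - a in
  cb r = t * cb (p - a) + (1 - t) * cb (q - a) /\
  cc r = t * cc (p - a) + (1 - t) * cc (q - a).
Proof.
have -> : t *: p + (1 - t) *: q - a = t *: (p - a) + (1 - t) *: (q - a).
  by rewrite !scalerBr addrACA -opprD -scalerDl subrKC scale1r.
by split; rewrite /cb /cc linearD !linearZ.
Qed.

(** The region on the right is convex and contains the vertices. Conversely, each of its points lies
    on a segment from [a] to the side [bc], so two binary convex combinations reach it. *)
Lemma triangleP p : convex_hull [set a; b; c] p <->
  [/\ 0 <= cb (p - a), 0 <= cc (p - a) & cb (p - a) + cc (p - a) <= 1].
Proof.
have [b1 c0 b0 c1] := coord2_bc.
split=> [|[b_ge0 c_ge0 bc_le1]].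
  pose Q := [set q : 'rV[R]_2 |
    [/\ 0 <= cb (q - a), 0 <= cc (q - a) & cb (q - a) + cc (q - a) <= 1]].
  suff /(_ p) : convex_hull [set a; b; c] `<=` Q by [].
  apply: smallest_sub => [x y t|x [[|]|] ->].
  - rewrite !inE => -[bx cx bcx] [by_ cy bcy].
    have [eb ec] := coord2_conv t%:num x y.
    have t0 : 0 <= t%:num by []. have t1 : t%:num <= 1 by [].
    change [/\ 0 <= cb (t%:num *: x + (1 - t%:num) *: y - a),
      0 <= cc (t%:num *: x + (1 - t%:num) *: y - a) &
      cb (t%:num *: x + (1 - t%:num) *: y - a) +
      cc (t%:num *: x + (1 - t%:num) *: y - a) <= 1].
    rewrite eb ec; split; nra.
  - by rewrite /Q /= subrr /cb /cc !linear0 addr0.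
  - by rewrite /Q /= b1 b0 addr0.
  - by rewrite /Q /= c0 c1 add0r.
move=> A [convA sA].
have [aA bA cA] : [/\ a \in A, b \in A & c \in A].
  by rewrite !inE; split; apply: sA; [left; left|left; right|right].
have conv2 (t : R) x y : 0 <= t -> t <= 1 -> x \in A -> y \in A ->
    t *: x + (1 - t) *: y \in A.
  by move=> t0 t1 xA yA; have := convA _ _ (Itv01 t0 t1) xA yA.
have ep := coord2E (p - a); set B := cb _ in ep b_ge0 bc_le1 *.
set C := cc _ in ep c_ge0 bc_le1 *.
have [BC0|BCn0] := eqVneq (B + C) 0.
  have B0 : B = 0 by lra. have C0 : C = 0 by lra.
  move: ep; rewrite B0 C0 !scale0r addr0 => /eqP; rewrite subr_eq0 => /eqP ->.
  by rewrite -inE.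
have BCgt0 : 0 < B + C by rewrite lt_def BCn0 addr_ge0.
(* The weight of [b] in the point where the ray from [a] through [p] meets [bc]. *)
pose s := B / (B + C).
have s0 : 0 <= s by rewrite divr_ge0 // ltW.
have s1 : s <= 1 by rewrite ler_pdivrMr // mul1r lerDl.
have qA := conv2 s b c s0 s1 bA cA.
have := conv2 (B + C) _ a (ltW BCgt0) bc_le1 qA aA.
rewrite inE; congr A.
have -> : p = a + (p - a) by rewrite subrKC.
rewrite ep scalerDr !scalerA mulrBr mulr1 [(B + C) * s]mulrC divfK //.
rewrite [B + C - B]addrC addKr scalerBl scale1r !scalerBr scalerDl opprD.
rewrite addrCA; congr (a + _).
by rewrite addrACA.
Qed.

(** Scaling by [l > 0] and translating keep the directions of the three sides and only move their
    bounds. *)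
Lemma homothet_octant H : homothet (convex_hull [set a; b; c]) H ->
  exists X Y Z : R, forall q,
    H q <-> [/\ cb q + cc q <= X, - cb q <= Y & - cc q <= Z].
Proof.
move=> [l [v [l0 ->]]].
exists (cb v + cc v + l * (1 + cb a + cc a)), (- (cb v + l * cb a)), (- (cc v + l * cc a)).
move=> q; split.
  move=> [x /triangleP[]]; rewrite /cb /cc !linearB /= => bx cx bcx <-.
  rewrite !linearD !linearZ /=.
  have := mulr_ge0 (ltW l0) bx; have := mulr_ge0 (ltW l0) cx.
  have : 0 <= l * (1 - (coord X ord0 x - coord X ord0 a +
                        (coord X ord_max x - coord X ord_max a))).
    by rewrite mulr_ge0 ?subr_ge0 // ltW.
  by rewrite /GRing.scale /=; split; lra.
move=> [hx hy hz]; exists (l^-1 *: (q - v)); last first.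
  by rewrite scalerA divff ?gt_eqF // scale1r subrK.
have li : 0 < l^-1 by rewrite invr_gt0.
apply/triangleP; move: hx hy hz; rewrite /cb /cc !linearB !linearZ /=.
set bq := coord _ _ q; set cq := coord _ _ q; set bv := coord _ _ v; set cv := coord _ _ v.
set ba := coord _ _ a; set ca := coord _ _ a; move=> hx hy hz.
rewrite /GRing.scale /= -!mulrDr; split.
- by rewrite subr_ge0 ler_pdivlMl //; lra.
- by rewrite subr_ge0 ler_pdivlMl //; lra.
by rewrite addrACA -mulrDr -opprD lerBlDr ler_pdivrMl //; lra.
Qed.

Lemma coord2_inj p q : cb p = cb q -> cc p = cc q -> p = q.
Proof. by move=> eb ec; rewrite (coord2E p) (coord2E q) eb ec. Qed.

Lemma homothet_colouring m k (P : {fset 'rV[R]_2}) : (0 < k)%N -> octant_colourable m k ->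
  exists color : 'rV[R]_2 -> 'I_k,
  forall H, homothet (convex_hull [set a; b; c]) H ->
    (m <= #|` [fset p in P | p \in H]%fset|)%N ->
    forall i, exists p, [/\ p \in P, H p & color p = i].
Proof.
move=> k0 col.
pose fx (p : P) := cb (val p) + cc (val p).
pose fy (p : P) := - cb (val p).
pose fz (p : P) := - cc (val p).
have [|f fP] := col P (rank fx) (rank fy) (rank fz) finset.setT.
  (* The three coordinates add up to 0, so the three weak inequalities are equalities. *)
  move=> p q _ _ /rank_le xpq /rank_le ypq /rank_le zpq; apply: val_inj.
  by rewrite /fx /fy /fz in xpq ypq zpq; apply: coord2_inj; lra.
(* Points outside [P] get colour 0. *)
exists (fun q => if insub q is Some p then f p else Ordinal k0) => H homH big i.
have [tx [ty [tz HP]]] := homothet_octant homH.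
pose N (g : P -> R) t := #|[set q | (g q <= t)%R]%SET|.
have [|p] := fP (N fx tx) (N fy ty) (N fz tz) _ i.
  apply: leq_trans big _; rewrite -(@card_fsub _ P) ?fset_sub // subset_leq_card //.
  apply/fintype.subsetP=> p; rewrite !inE /= => /andP[_ /set_mem/HP[hx hy hz]].
  by rewrite !rank_lt; apply/and3P.
rewrite !inE /= !rank_lt => /and3P[hx hy hz] fp.
by exists (val p); split; [exact: valP | exact/HP | rewrite valK].
Qed.

End Triangle.

(** * From the real threshold to the theorem *)

Lemma threshold_colourable (R : realType) k : (0 < k)%N ->
  exists2 m, octant_colourable m k & forall n, threshold R k <= n%:R -> (m <= n)%N.
Proof.
case: k => [//|[|k]] _.
  (* For one colour the threshold [12 / 23] is positive, so a count reaching it is at least 1. *)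
  exists 1%N; first exact: octant_colourable1.
  by move=> n; rewrite threshold1 -(ltr0n R); apply: lt_le_trans; lra.
exists (12 * 23 ^ (up_log 2 k.+2).-1)%N; last by move=> n; rewrite threshold_up_log // ler_nat.
apply: octant_colourable_fewer (octant_colourable_pow2 _).
by rewrite prednK ?up_log_gt0 // up_logP.
Qed.

Theorem corollary6 (R : realType) :
  (forall (T : set 'rV[R]_2), is_triangle T ->
   forall k : nat, (0 < k)%N ->
   forall P : {fset 'rV[R]_2},
   exists color : 'rV[R]_2 -> 'I_k,
   forall H : set 'rV[R]_2, homothet T H ->
     threshold R k <= #|` [fset p in P | p \in H]%fset |%:R ->
     forall i : 'I_k, exists p : 'rV[R]_2,
       [/\ p \in P, H p & color p = i])
  /\ (forall k : nat, (0 < k)%N ->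
        threshold R k <= 12 * (k%:R : R) `^ log2 (23 : R))
  /\ ((fun k : nat => 12 * (k%:R : R) `^ log2 (23 : R) : R^o)
       =O_\oo (fun k : nat => (k%:R : R) `^ (453 / 100) : R^o)).
Proof.
split; last split.
- move=> T [a [b [c [free_bc ->]]]] k k0 P.
  have [m col mP] := threshold_colourable R k0.
  have [color colorP] := homothet_colouring free_bc P k0 col.
  by exists color => H homH /mP; apply: colorP.
- exact: threshold_le.
(* For [k >= 1] the power grows with the exponent and [log2 23 <= 453 / 100], so the constant 12
   suffices. *)
apply/eqO_exP; exists 12 => //; near=> k.
have k1 : (1 <= k)%N by near: k; exists 1%N.
rewrite !ger0_norm ?mulr_ge0 ?powR_ge0 // ler_pM2l //.
by apply: ler_powR (log2_23_le R); rewrite ler1n.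
Unshelve. all: by end_near.
Qed.
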